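(* Let $A,B,C$ be complex vector spaces of dimension $3$ with bases $a_0,a_1,a_2$, $b_0,b_1,b_2$, $c_0,c_1,c_2$, and let $$T_{skewcw,2}=\sum_{j=1}^2\left(a_0\otimes b_j\otimes c_j+a_j\otimes b_0\otimes c_j\right)+\left(a_1\otimes b_2-a_2\otimes b_1\right)\otimes c_0.$$ Then $\mathbf{R}(T_{skewcw,2}^{\boxtimes 2})\le 18$.
   Context: The rank $\mathbf{R}(T)$ of a tensor $T$ is the smallest $r$ such that $T$ is a sum of $r$ tensors of the form $a\otimes b\otimes c$. The Kronecker square $T^{\boxtimes 2}$ is $T\otimes T$ regarded as a 3-way tensor in $(A\otimes A)\otimes(B\otimes B)\otimes(C\otimes C)$. *)

(* Defs.v *)
From HB Require Import structures.
From mathcomp Require Import all_boot all_order all_algebra.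
From mathcomp Require Import boolp reals.
From mathcomp Require Import complex.

Set Implicit Arguments.
Unset Strict Implicit.
Unset Printing Implicit Defensive.

Import GRing.Theory.
Local Open Scope ring_scope.

(** A finite-dimensional space with a basis indexed by [I] is modelled by
    [{ffun I -> K}]; the product basis then makes [{ffun I * J -> K}] the tensor
    product of [{ffun I -> K}] and [{ffun J -> K}].  As [I * J * L] associates
    to the left, [{ffun I * J * L -> K}] is the space of 3-way tensors. *)

Definition tprod (K : fieldType) (I J : finType)
    (x : {ffun I -> K}) (y : {ffun J -> K}) : {ffun I * J -> K} :=
  [ffun p => x p.1 * y p.2].

Notation "x ⊗ y" := (tprod x y) (at level 40, left associativity) : ring_scope.

Definition bvec (K : fieldType) (n k : nat) : {ffun 'I_n -> K} :=
  [ffun i : 'I_n => (i == k :> nat)%:R].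

Definition sum_of_simple (K : fieldType) (I J L : finType)
    (T : {ffun I * J * L -> K}) (r : nat) : Prop :=
  exists (a : 'I_r -> {ffun I -> K}) (b : 'I_r -> {ffun J -> K})
         (c : 'I_r -> {ffun L -> K}),
    T = \sum_(s < r) a s ⊗ b s ⊗ c s.

Lemma sum_of_simple_ex (K : fieldType) (I J L : finType)
    (T : {ffun I * J * L -> K}) :
  exists r, `[< sum_of_simple T r >].
Proof.
pose d (X : finType) (x : X) : {ffun X -> K} := [ffun y => (y == x)%:R].
pose v (s : 'I_#|{: I * J * L}|) : I * J * L := enum_val s.
exists #|{: I * J * L}|; apply/asboolP.
exists (fun s => [ffun y => T (v s) * d I (v s).1.1 y]),
       (fun s => d J (v s).1.2), (fun s => d L (v s).2).
apply/ffunP => x; rewrite sum_ffunE (bigD1 (enum_rank x)) //= big1 => [|s sx].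
  by rewrite !ffunE /v enum_rankK !eqxx !mulr1 addr0.
have {sx}: x != v s by apply: contra sx => /eqP ->; rewrite /v enum_valK.
case: x => [[x1 x2] x3]; case: (v s) => [[y1 y2] y3].
rewrite !ffunE /= !xpair_eqE.
by case: eqP; case: eqP; case: eqP; rewrite ?mulr0 ?mul0r.
Qed.

Definition tensor_rank (K : fieldType) (I J L : finType)
    (T : {ffun I * J * L -> K}) : nat :=
  ex_minn (sum_of_simple_ex T).

(** The coordinates of [T ⊗ T'], regrouped as a 3-way tensor in
    (A ⊗ A') ⊗ (B ⊗ B') ⊗ (C ⊗ C'). *)
Definition kronecker (K : fieldType) (I J L I' J' L' : finType)
    (T : {ffun I * J * L -> K}) (T' : {ffun I' * J' * L' -> K}) :
    {ffun (I * I') * (J * J') * (L * L') -> K} :=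
  [ffun p : (I * I') * (J * J') * (L * L') =>
     let: ((i, i'), (j, j'), (l, l')) := p in
     (T ⊗ T') ((i, j, l), (i', j', l'))].

Definition T_skewcw2 (K : fieldType) : {ffun 'I_3 * 'I_3 * 'I_3 -> K} :=
  let a := bvec K 3%N in let b := bvec K 3%N in let c := bvec K 3%N in
  \sum_(1 <= j < 3) (a 0%N ⊗ b j ⊗ c j + a j ⊗ b 0%N ⊗ c j)
  + (a 1%N ⊗ b 2%N - a 2%N ⊗ b 1%N) ⊗ c 0%N.

(* Main.v *)
Require Import Defs.
From mathcomp Require Import all_boot all_order all_algebra.
From mathcomp Require Import boolp reals.
From mathcomp Require Import complex.
From mathcomp Require Import ring.

(** Reindexing by Z/3 and up to signs, [T_skewcw2] is the Levi-Civita tensor,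
    so its Kronecker square is the polarization of the 3 x 3 determinant.  For a
    primitive cube root of unity w,
      18 x y z = (sum_(k < 3) (x + w^k y + w^(2k) z)^3) - 3 (x^3 + y^3 + z^3).
    Apply this to each of the six monomials of the determinant: every entry
    occurs in exactly one even and one odd permutation, so the cubes of single
    entries cancel and 6 * 3 = 18 cubes remain.  The permutations of Z/3 are the
    maps x |-> +-x + b, with sign +-1. *)

Section TensorRank.

Import GRing.Theory.
Local Open Scope ring_scope.

Lemma tensor_rank_le_card (K : fieldType) (I J L S : finType)
    (T : {ffun I * J * L -> K}) (a : S -> {ffun I -> K})
    (b : S -> {ffun J -> K}) (c : S -> {ffun L -> K}) :
  T = \sum_s a s ⊗ b s ⊗ c s -> (tensor_rank T <= #|S|)%N.
Proof.
move=> defT; rewrite /tensor_rank; case: ex_minnP => m _; apply.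
apply/asboolP; exists (a \o enum_val), (b \o enum_val), (c \o enum_val).
by rewrite defT (reindex (@enum_val _ S)) //; apply/onW_bij/enum_val_bij.
Qed.

Variable K : fieldType.

(** The quadratic character mod 3. When [i + j + k = 0], [chi3 (j - i)] is the Levi-Civita symbol of
    [(i, j, k)]. *)
Definition chi3 (d : 'I_3) : K := (d == 1)%:R - (d == 2%:R)%:R.

(** Signs of the diagonal basis changes, which flip [b_0] and [c_2]. *)
Definition sgnB (j : 'I_3) : K := (-1) ^+ (j == 0).
Definition sgnC (l : 'I_3) : K := (-1) ^+ (l == 2%:R).

(** The third Levi-Civita index is [- l], so that the three indices sum to zero. *)
Lemma T_skewcw2E (i j l : 'I_3) :
  T_skewcw2 K (i, j, l) =
  sgnB j * sgnC l * (l == i + j)%:R * chi3 (j - i).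
Proof.
rewrite /T_skewcw2 big_nat_recl // big_nat1 !ffunE /sgnB /sgnC /chi3.
case: i => [[|[|[|//]]] ?]; case: j => [[|[|[|//]]] ?];
case: l => [[|[|[|//]]] ?]; rewrite -!val_eqE /=; ring.
Qed.

(** Orthogonality of the characters of Z/3; [2 * l] stands for [- l] in natural exponents. *)
Lemma sum_cube_root_unity (w : K) (i j l : 'I_3) : w ^+ 2 + w + 1 = 0 ->
  \sum_(k < 3) w ^+ (k * i) * w ^+ (k * j) * w ^+ (k * (2 * l))
  = 3%:R * (l == i + j)%:R.
Proof.
move=> w0; have w2 : w ^+ 2 = - w - 1 by rewrite -[RHS]add0r -w0; ring.
have w3 : w ^+ 3 = 1 by rewrite exprS w2 mulrBr mulrN -expr2 w2; ring.
have wE n : w ^+ n = w ^+ (n %% 3).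
  by rewrite {1}(divn_eq n 3) exprD mulnC exprM w3 expr1n mul1r.
rewrite !big_ord_recr big_ord0 /= -!exprD.
rewrite (wE (1 * _ + _ + _)%N) (wE (2 * _ + _ + _)%N).
case: i => [[|[|[|//]]] ?]; case: j => [[|[|[|//]]] ?];
by case: l => [[|[|[|//]]] ?]; rewrite -!val_eqE /= ?w2; ring.
Qed.

(** Product of two Levi-Civita symbols, expanded over signed permutations. If [i = j], the triple
    [(i, j, - (i + j))] is constant, and even and odd maps cancel. *)
Lemma affine_perm_sum (i j i' j' l' : 'I_3) :
  \sum_(e : bool) \sum_(b < 3) (-1) ^+ e *
    ((i' == (-1) ^+ e * i + b) && (j' == (-1) ^+ e * j + b) &&
     (- l' == (-1) ^+ e * - (i + j) + b))%:R
  = (l' == i' + j')%:R * chi3 (j - i) * chi3 (j' - i').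
Proof.
have chi3M (d d' : 'I_3) :
    chi3 d * chi3 d' = \sum_(e : bool) (-1) ^+ e * (d' == (-1) ^+ e * d)%:R.
  rewrite big_bool /chi3; case: d => [[|[|[|//]]] ?];
  by case: d' => [[|[|[|//]]] ?]; rewrite -!val_eqE /=; ring.
rewrite -mulrA chi3M mulr_sumr; apply: eq_bigr => e _.
(* The first coordinate forces the translation [b]. *)
rewrite (bigD1 (i' - (-1) ^+ e * i)) //= big1 => [|b nb]; last first.
  suff /negPf-> : i' != (-1) ^+ e * i + b by rewrite mulr0.
  by apply: contra nb => /eqP->; rewrite addrC addKr.
rewrite addr0 mulrCA -natrM mulnb; congr (_ * (nat_of_bool _)%:R).
by case: e; case: i => [[|[|[|//]]] ?]; case: j => [[|[|[|//]]] ?];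
  case: i' => [[|[|[|//]]] ?]; case: j' => [[|[|[|//]]] ?];
  case: l' => [[|[|[|//]]] ?].
Qed.

Lemma tensor_rank_skewcw2_square (w : K) : w ^+ 2 + w + 1 = 0 ->
  3%:R != 0 :> K ->
  (tensor_rank (kronecker (T_skewcw2 K) (T_skewcw2 K)) <= 18)%N.
Proof.
move=> w0 nz3.
have -> : 18%N = #|{: bool * 'I_3 * 'I_3}|
  by rewrite !card_prod card_bool card_ord.
pose f (s : bool * 'I_3 * 'I_3) (x : 'I_3) : 'I_3 := (-1) ^+ s.1.1 * x + s.1.2.
(* A permutation [(e, b)] and a character [k] give one simple term, supported on the graph of the
   permutation, with C indices negated; [1/3] normalizes the character sum. *)
apply: (@tensor_rank_le_card _ _ _ _ (bool * 'I_3 * 'I_3)%type _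
  (fun s => [ffun p : 'I_3 * 'I_3 =>
     (-1) ^+ s.1.1 / 3%:R * w ^+ (s.2 * p.1) * (p.2 == f s p.1)%:R])
  (fun s => [ffun p : 'I_3 * 'I_3 =>
     sgnB p.1 * sgnB p.2 * w ^+ (s.2 * p.1) * (p.2 == f s p.1)%:R])
  (fun s => [ffun p : 'I_3 * 'I_3 =>
     sgnC p.1 * sgnC p.2 * w ^+ (s.2 * (2 * p.1)) *
     (- p.2 == f s (- p.1))%:R])).
apply/ffunP => -[[[i i'] [j j']] [l l']].
rewrite sum_ffunE [LHS]ffunE [LHS]ffunE !T_skewcw2E.
pose c := sgnB j * sgnC l * sgnB j' * sgnC l'.
transitivity (c / 3%:R *
  (\sum_(k < 3) w ^+ (k * i) * w ^+ (k * j) * w ^+ (k * (2 * l))) *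
  \sum_(e : bool) \sum_(b < 3) (-1) ^+ e *
    ((i' == (-1) ^+ e * i + b) && (j' == (-1) ^+ e * j + b) &&
     (- l' == (-1) ^+ e * - l + b))%:R).
  rewrite sum_cube_root_unity // /c; have [->|_] := eqVneq l (i + j).
    by rewrite affine_perm_sum !mulr1; field.
  by rewrite !(mulr0, mul0r).
rewrite pair_big mulrC mulr_suml.
under eq_bigr => s _ do rewrite !mulr_sumr.
rewrite pair_big; apply: eq_bigr => -[[e b] k] _.
by rewrite !ffunE /= /f /c -!mulnb !natrM; ring.
Qed.

End TensorRank.

Theorem theorem2p9 (R : realType) :
  tensor_rank (kronecker (T_skewcw2 R[i]) (T_skewcw2 R[i])) <= 18.
Proof.
(* The equation solved is [w ^+ 2 = - 1 - w]. *)
have [w w0] := @GRing.solve_monicpoly R[i] 2 (fun=> (-1)%R) isT.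
apply: (@tensor_rank_skewcw2_square _ w); last by rewrite Num.Theory.pnatr_eq0.
by rewrite w0 !big_ord_recr big_ord0 /=; ring.
Qed.
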